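(* Let $0<|q|<1$ and let $a,c,e$ be complex parameters such that all denominators below are nonzero. Then \[\frac{(a;q)_\infty(qc;q)_\infty}{(ae;q)_\infty(qc/e;q)_\infty} =\sum_{k=0}^{\infty}\frac{1-q^{3k}c}{1-c}\, \frac{(a;q)_k(c;q)_k(e;q)_k(q/e;q)_k(ae/c;q)_k(qc/ae;q)_k}{(q;q)_{2k}(ae;q)_{2k}(qc/e;q)_{2k}}\,q^{3k^2-k}(ac)^k \left\{1-q^{3k}\frac{a(1-q^{3k+1}a)(1-q^kc)(1-q^ke)(1-q^{1+k}c/ae)}{(1-q^{3k}c)(1-q^{1+2k})(1-q^{2k}ae)(1-q^{1+2k}c/e)}\right\}.\]
   Context: For an indeterminate $x$ and $n\in\mathbb{N}_0$, $(x;q)_0=1$, $(x;q)_n=(1-x)(1-qx)\cdots(1-q^{n-1}x)$, and $(x;q)_\infty=\prod_{j\ge0}(1-q^jx)$ for $|q|<1$. *)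

(* Defs.v *)
(* Stdlib reals with Coquelicot's complex numbers. *)
From Stdlib Require Import Reals.
From Coquelicot Require Import Coquelicot.

Open Scope C_scope.

Fixpoint qpoch (x q : C) (n : nat) : C :=
  match n with
  | O => 1
  | S m => qpoch x q m * (1 - q ^ m * x)
  end.

(* [lim] is total; for [Cmod q < 1] the partial products are Cauchy, so this
   is their genuine limit. *)
Definition qpoch_inf (x q : C) : C :=
  lim (T := C_CompleteNormedModule)
    (filtermap (fun n : nat => qpoch x q n) eventually).

(* Main.v *)
Require Import Defs.
From Stdlib Require Import Reals Lra Lia.
From Coquelicot Require Import Coquelicot.

(** Multiplied by [1 - c], the [k]-th term [U k a c] of the series is [base * bracket] below. With
    [rho = (1 - a) (1 - c) / ((1 - a e) (1 - q c / e))] it satisfies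
    [U k a c - rho * U k (q a) (q c)
     = (1 - q^(2k)) base k - (1 - q^(2(k+1))) base (k+1)],
    so the sum [F a c] obeys [F a c = rho * F (q a) (q c)]. Iterating multiplies the factors [rho]
    up to the asserted quotient of infinite products, because [F (q^N a) (q^N c) -> 1]. *)

Open Scope C_scope.

(** The relation for [F] gives the value only if limit and sum can be interchanged in
    [F (q^N a) (q^N c)]. This interchange and the convergence of the series come out of one finite
    computation on a square of indices with errors [O(|q|^n)], which is why the estimates below are
    uniform in [k] and [N]. Only the terms with [k >= 1] decay in [N]: there
    [q^(3k^2-k) (q^(2N) a c)^k] supplies a factor [q^(k+N)], whereas [base] is 1 at [k = 0]. The
    parameters [a] and [c] are shifted together because this fixes [a e / c] and [q c / (a e)]. The
    multiplier [1 - q^(2k)] removes the boundary term at [k = 0] and, for [k >= 1], cancels the last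
    factor of [(q;q)_(2k)]. *)

(** * Limits of complex sequences *)

Definition Ctends (u : nat -> C) (l : C) : Prop :=
  is_lim_seq (fun n => Cmod (u n - l)) 0%R.

(** Convergence is phrased through real moduli so that squeezing and the arithmetic of real limits
    apply; this is the bridge to the filters behind [lim] and [is_series]. *)
Lemma Ctends_filterlim (u : nat -> C) (l : C) :
  Ctends u l <-> filterlim u eventually (locally (l : C_NormedModule)).
Proof.
split.
- intros H. apply (filterlim_locally_ball_norm (U := C_NormedModule)).
  intros eps. apply is_lim_seq_spec in H. specialize (H eps).
  revert H. apply filter_imp. intros n Hn.
  change (Cmod (u n - l) < eps)%R.
  rewrite Rminus_0_r, Rabs_pos_eq in Hn; [exact Hn | apply Cmod_ge_0].
- intros H. apply is_lim_seq_spec. intros eps.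
  apply (proj1 (filterlim_locally_ball_norm (U := C_NormedModule) u l)) with (eps := eps) in H.
  revert H. apply filter_imp. intros n Hn.
  rewrite Rminus_0_r, Rabs_pos_eq; [exact Hn | apply Cmod_ge_0].
Qed.

(** The image filter of a convergent sequence is Cauchy, and completeness makes a Cauchy filter
    converge to its [lim]. Existence of some limit thus justifies the total [lim] in [qpoch_inf]. *)
Lemma Ctends_lim (u : nat -> C) (l : C) :
  Ctends u l -> Ctends u (lim (T := C_CompleteNormedModule) (filtermap u eventually)).
Proof.
intros H. apply Ctends_filterlim in H.
apply Ctends_filterlim.
apply filterlim_locally. intros eps.
refine (complete_cauchy (T := C_CompleteNormedModule) (filtermap u eventually) _ _ eps).
apply cauchy_distance.
intros e. exists (ball l (pos_div_2 e)). split.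
- apply H. now exists (pos_div_2 e).
- intros x y Hx Hy. replace (pos e) with (pos_div_2 e + pos_div_2 e)%R by (simpl; lra).
  apply ball_triangle with l; [now apply ball_sym | assumption].
Qed.

Lemma Ctends_of_le (u : nat -> C) (l : C) (b : nat -> R) :
  (forall n, Cmod (u n - l) <= b n)%R -> is_lim_seq b 0%R -> Ctends u l.
Proof.
intros H Hb. unfold Ctends.
apply is_lim_seq_le_le with (u := fun _ => 0%R) (w := b); [| apply is_lim_seq_const | exact Hb].
intros n. split; [apply Cmod_ge_0 | apply H].
Qed.

Lemma Ctends_unique (u : nat -> C) (l m : C) : Ctends u l -> Ctends u m -> l = m.
Proof.
intros H H'. apply Ctends_filterlim in H. apply Ctends_filterlim in H'.
exact (filterlim_locally_unique (V := C_NormedModule) u l m H H').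
Qed.

Lemma Ctends_incr_1 (u : nat -> C) (l : C) : Ctends u l -> Ctends (fun n => u (S n)) l.
Proof. intros H. exact (proj1 (is_lim_seq_incr_1 _ _) H). Qed.

Lemma Ctends_const (l : C) : Ctends (fun _ => l) l.
Proof.
apply Ctends_of_le with (b := fun _ => 0%R); [| apply is_lim_seq_const].
intros _. unfold Cminus. rewrite Cplus_opp_r, Cmod_0. apply Rle_refl.
Qed.

Lemma Ctends_Cmod (u : nat -> C) (l : C) :
  Ctends u l -> is_lim_seq (fun n => Cmod (u n)) (Cmod l).
Proof.
intros H. apply Ctends_filterlim in H.
exact (filterlim_comp _ _ _ _ _ _ _ _ H (filterlim_norm (V := C_NormedModule) l)).
Qed.

Lemma Ctends_bounded (u : nat -> C) (l : C) :
  Ctends u l -> exists M, forall n, (Cmod (u n) <= M)%R.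
Proof.
intros H. apply Ctends_filterlim in H.
destruct (filterlim_bounded (K := C_AbsRing) (V := C_NormedModule) u) as [M HM].
- now exists l.
- exists M. exact HM.
Qed.

Lemma Ctends_mult (u v : nat -> C) (l m : C) :
  Ctends u l -> Ctends v m -> Ctends (fun n => u n * v n) (l * m).
Proof.
intros Hu Hv.
apply Ctends_of_le with
  (b := fun n => (Cmod (u n - l) * Cmod (v n) + Cmod l * Cmod (v n - m))%R).
- intros n. replace (u n * v n - l * m) with ((u n - l) * v n + l * (v n - m)) by ring.
  rewrite <- !Cmod_mult. apply Cmod_triangle.
- replace (Finite 0) with (Finite (0 * Cmod m + Cmod l * 0)%R) by (f_equal; ring).
  apply is_lim_seq_plus'; apply is_lim_seq_mult'; auto using Ctends_Cmod.
  apply is_lim_seq_const.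
Qed.

Lemma Ctends_inv (u : nat -> C) (l : C) :
  l <> 0 -> (forall n, u n <> 0) -> Ctends u l -> Ctends (fun n => / u n) (/ l).
Proof.
intros Hl Hu0 Hu.
assert (Hm : Cmod l <> 0%R) by (apply Rgt_not_eq, Cmod_gt_0, Hl).
apply Ctends_of_le with (b := fun n => (Cmod (u n - l) / (Cmod l * Cmod (u n)))%R).
- intros n. replace (/ u n - / l) with (- ((u n - l) / (l * u n))) by (field; auto).
  rewrite Cmod_opp, Cmod_div, Cmod_mult by (apply Cmult_neq_0; auto). apply Rle_refl.
- replace (Finite 0) with (Finite (0 / (Cmod l * Cmod l))%R) by (f_equal; field; auto).
  apply is_lim_seq_div'; [exact Hu | |].
  + apply is_lim_seq_mult'; [apply is_lim_seq_const | now apply Ctends_Cmod].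
  + now apply Rmult_integral_contrapositive_currified.
Qed.

Lemma Cmod_le_geom_sum (u : nat -> C) (K r : R) :
  (0 <= r < 1)%R -> (0 <= K)%R ->
  (forall n, Cmod (u (S n) - u n) <= K * r ^ n)%R ->
  forall n, (Cmod (u n - u O) <= K / (1 - r))%R.
Proof.
intros Hr HK Hu n.
(* The induction needs the sharper bound by the partial geometric sum. *)
apply Rle_trans with (K / (1 - r) * (1 - r ^ n))%R.
- induction n as [|n IH].
  + replace (u O - u O) with (RtoC 0) by ring. rewrite Cmod_0. simpl. lra.
  + replace (u (S n) - u O) with ((u (S n) - u n) + (u n - u O)) by ring.
    apply Rle_trans with (1 := Cmod_triangle _ _).
    replace (K / (1 - r) * (1 - r ^ S n))%R
      with (K * r ^ n + K / (1 - r) * (1 - r ^ n))%R by (simpl; field; lra).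
    apply Rplus_le_compat; auto.
- assert (0 <= r ^ n)%R by (apply pow_le; lra).
  assert (0 <= K / (1 - r))%R by (apply Rdiv_le_0_compat; lra).
  nra.
Qed.

Lemma Ctends_of_geom (u : nat -> C) (K r : R) :
  (0 <= r < 1)%R -> (forall n, Cmod (u (S n) - u n) <= K * r ^ n)%R ->
  exists l, Ctends u l.
Proof.
intros Hr Hu.
destruct (ex_series_le (V := C_CompleteNormedModule) (fun n => u (S n) - u n)
            (fun n => K * r ^ n)%R Hu) as [s Hs].
{ apply (ex_series_scal (K := R_AbsRing) (V := R_NormedModule) K (fun n => (r ^ n)%R)).
  apply ex_series_geom. rewrite Rabs_pos_eq; lra. }
(* The increments sum to [s], and their partial sums telescope to [u (S n) - u O]; hence the added
   [u O] and the index shift below. *)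
exists (s + u O).
assert (E : forall n, sum_n (G := C_AbelianMonoid) (fun n => u (S n) - u n) n = u (S n) - u O).
{ induction n as [|n IH].
  - rewrite sum_O. reflexivity.
  - rewrite sum_Sn, IH. change (u (S n) - u O + (u (S (S n)) - u (S n)) = u (S (S n)) - u O). ring. }
apply (proj2 (is_lim_seq_incr_1 (fun n => Cmod (u n - (s + u O))) 0%R)).
apply (proj2 (Ctends_filterlim _ _)) in Hs.
apply is_lim_seq_ext with (2 := Hs). intros n. rewrite E. f_equal. ring.
Qed.

(** * Doubly indexed families: uniform bounds and telescoping *)

(** Decay such as [O(|q|^(k+N))] is expressed as boundedness after division by the power of [q], so
    closure under sums and products suffices for all estimates. *)
Definition bounded (f : nat -> nat -> C) : Prop :=
  exists M, forall k N, (Cmod (f k N) <= M)%R.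

Lemma bounded_const (x : C) : bounded (fun _ _ => x).
Proof. exists (Cmod x). intros _ _. apply Rle_refl. Qed.

Lemma bounded_plus (f g : nat -> nat -> C) :
  bounded f -> bounded g -> bounded (fun k N => f k N + g k N).
Proof.
intros [M HM] [M' HM']. exists (M + M')%R. intros k N.
apply Rle_trans with (1 := Cmod_triangle _ _). now apply Rplus_le_compat.
Qed.

Lemma bounded_opp (f : nat -> nat -> C) : bounded f -> bounded (fun k N => - f k N).
Proof. intros [M HM]. exists M. intros k N. now rewrite Cmod_opp. Qed.

Lemma bounded_minus (f g : nat -> nat -> C) :
  bounded f -> bounded g -> bounded (fun k N => f k N - g k N).
Proof. intros Hf Hg. apply bounded_plus; [exact Hf | now apply bounded_opp]. Qed.

Lemma bounded_mult (f g : nat -> nat -> C) :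
  bounded f -> bounded g -> bounded (fun k N => f k N * g k N).
Proof.
intros [M HM] [M' HM']. exists (M * M')%R. intros k N.
rewrite Cmod_mult. apply Rmult_le_compat; auto using Cmod_ge_0.
Qed.

Lemma bounded_ext (f g : nat -> nat -> C) :
  (forall k N, f k N = g k N) -> bounded f -> bounded g.
Proof. intros E [M HM]. exists M. intros k N. rewrite <- E. apply HM. Qed.

(* Summing the relation over the rectangle [k <= n], [N < n] expresses the [n]-th partial sum of
   the [W k 0] through the column sum at [N = n], where only [W 0 n] survives in the limit. *)
Lemma is_series_double_telescope (q : C) (W G : nat -> nat -> C) (P : nat -> C) (l : C) :
  q <> 0 -> (Cmod q < 1)%R ->
  (forall k N, W k N - W k (S N) = G k N - G (S k) N) ->
  (forall N, G O N = 0) ->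
  bounded (fun k N => G (S k) N / q ^ (k + N)) ->
  bounded (fun k N => W (S k) N / q ^ (k + N)) ->
  bounded (fun _ N => (W O N - P N) / q ^ N) ->
  Ctends P l ->
  is_series (K := C_AbsRing) (V := C_NormedModule) (fun k => W k O) l.
Proof.
intros Hq0 Hq HWG HG0 [K1 HG] [K2 HW] [K3 HW0] HP.
assert (Hr : (0 <= Cmod q < 1)%R) by (split; [apply Cmod_ge_0 | exact Hq]).
assert (scale : forall (x : C) (n : nat) (K : R),
  (Cmod (x / q ^ n) <= K)%R -> (Cmod x <= K * Cmod q ^ n)%R).
{ intros x n K H. rewrite <- Cmod_pow.
  replace x with (x / q ^ n * q ^ n) at 1 by (field; now apply Cpow_nz).
  rewrite Cmod_mult. apply Rmult_le_compat_r; [apply Cmod_ge_0 | exact H]. }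
pose (K := Rmax K1 (Rmax K2 K3)).
assert (HK1 : (K1 <= K)%R) by apply Rmax_l.
assert (HK2 : (K2 <= K)%R) by (eapply Rle_trans; [apply Rmax_l | apply Rmax_r]).
assert (HK3 : (K3 <= K)%R) by (eapply Rle_trans; [apply Rmax_r | apply Rmax_r]).
clearbody K.
assert (HK : (0 <= K)%R) by (apply Rle_trans with (2 := HK1), Rle_trans with (2 := HG O O), Cmod_ge_0).
assert (HG' : forall k N, (Cmod (G (S k) N) <= K * Cmod q ^ k * Cmod q ^ N)%R).
{ intros k N. rewrite Rmult_assoc, <- pow_add. apply scale. now apply Rle_trans with K1. }
assert (HW' : forall k N, (Cmod (W (S k) N) <= K * Cmod q ^ k * Cmod q ^ N)%R).
{ intros k N. rewrite Rmult_assoc, <- pow_add. apply scale. now apply Rle_trans with K2. }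
assert (HW0' : forall N, (Cmod (W O N - P N) <= K * Cmod q ^ N)%R).
{ intros N. apply scale. apply Rle_trans with K3; [exact (HW0 O N) | exact HK3]. }
set (r := Cmod q) in *.
pose (T := fun n N => sum_n (G := C_AbelianMonoid) (fun k => W k N) n).
assert (T0 : forall N, T O N = W O N) by (intros N; unfold T; now rewrite sum_O).
assert (TS : forall n N, T (S n) N = T n N + W (S n) N)
  by (intros n N; unfold T; rewrite sum_Sn; reflexivity).
(* Summing over [k <= n] telescopes to [G O N - G (S n) N], and [G O N] vanishes. *)
assert (HT : forall n N, T n N - T n (S N) = - G (S n) N).
{ induction n as [|n IH]; intros N.
  - rewrite !T0, HWG, HG0. ring.
  - rewrite !TS. replace (T n N + W (S n) N - (T n (S N) + W (S n) (S N)))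
      with ((T n N - T n (S N)) + (W (S n) N - W (S n) (S N))) by ring.
    rewrite IH, HWG. ring. }
assert (HA : forall n N, (Cmod (T n N - W O N) <= K * r ^ N / (1 - r))%R).
{ intros n N. rewrite <- T0. apply (Cmod_le_geom_sum (fun n => T n N)).
  - exact Hr.
  - apply Rmult_le_pos; [exact HK | apply pow_le; lra].
  - intros m. rewrite TS. replace (T m N + W (S m) N - T m N) with (W (S m) N) by ring.
    replace (K * r ^ N * r ^ m)%R with (K * r ^ m * r ^ N)%R by ring. apply HW'. }
assert (HB : forall n N, (Cmod (T n N - T n O) <= K * r ^ n / (1 - r))%R).
{ intros n N. apply (Cmod_le_geom_sum (fun N => T n N)).
  - exact Hr.
  - apply Rmult_le_pos; [exact HK | apply pow_le; lra].
  - intros m. replace (T n (S m) - T n m) with (G (S n) m).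
    + apply HG'.
    + replace (T n (S m) - T n m) with (- (T n m - T n (S m))) by ring. rewrite HT. ring. }
apply (proj1 (Ctends_filterlim (fun n => T n O) l)).
apply Ctends_of_le with
  (b := fun n => ((K / (1 - r) + K / (1 - r) + K) * r ^ n + Cmod (P n - l))%R).
(* On the diagonal [N = n], the drift from column 0, the entries with [k >= 1] and the gap between
   [W O n] and [P n] are all [O(r^n)]. *)
- intros n.
  replace (T n O - l) with
    (- (T n n - T n O) + (T n n - W O n) + (W O n - P n) + (P n - l)) by ring.
  apply Rle_trans with (1 := Cmod_triangle _ _). apply Rplus_le_compat_r.
  apply Rle_trans with (1 := Cmod_triangle _ _).
  apply Rle_trans with (1 := Rplus_le_compat_r _ _ _ (Cmod_triangle _ _)).
  rewrite Cmod_opp. specialize (HA n n). specialize (HB n n). specialize (HW0' n).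
  unfold Rdiv in *. lra.
- replace (Finite 0) with (Finite ((K / (1 - r) + K / (1 - r) + K) * 0 + 0)%R) by (f_equal; ring).
  apply is_lim_seq_plus'; [| exact HP].
  apply is_lim_seq_mult'; [apply is_lim_seq_const |].
  apply is_lim_seq_geom. rewrite Rabs_pos_eq; lra.
Qed.

(** * Finite and infinite q-shifted factorials *)

Lemma pow_le_1 (r : R) (n : nat) : (0 <= r < 1)%R -> (r ^ n <= 1)%R.
Proof. intros Hr. rewrite <- (pow1 n). apply pow_incr. lra. Qed.

Lemma qpoch_S_l (x q : C) (n : nat) : qpoch x q (S n) = (1 - x) * qpoch (q * x) q n.
Proof.
induction n as [|n IH].
- simpl. ring.
- change (qpoch x q (S (S n))) with (qpoch x q (S n) * (1 - q ^ S n * x)).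
  rewrite IH. simpl. ring.
Qed.

Lemma qpoch_shift (x q : C) (n : nat) :
  (1 - x) * qpoch (q * x) q n = qpoch x q n * (1 - q ^ n * x).
Proof. rewrite <- qpoch_S_l. reflexivity. Qed.

Lemma qpoch_add (x q : C) (m n : nat) : qpoch x q (m + n) = qpoch x q m * qpoch (q ^ m * x) q n.
Proof.
induction n as [|n IH].
- rewrite Nat.add_0_r. simpl. ring.
- rewrite Nat.add_succ_r. simpl. rewrite IH, Cpow_add_r. ring.
Qed.

Lemma Cmod_1_minus_le (x : C) : (Cmod (1 - x) <= 1 + Cmod x)%R.
Proof.
pose proof (Cmod_triangle 1 (- x)) as H. rewrite Cmod_opp, Cmod_1 in H. exact H.
Qed.

Lemma Cmod_1_minus_ge (x : C) : (1 - Cmod x <= Cmod (1 - x))%R.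
Proof.
pose proof (Cmod_triangle (1 - x) x) as H.
replace (1 - x + x) with (RtoC 1) in H by ring. rewrite Cmod_1 in H. lra.
Qed.

(** Each factor satisfies [|1 - q^i x| <= 1 + |q|^i |x| <= exp (|q|^i |x|)], and the exponents form
    a geometric series. The bound is uniform in [n] and increasing in [|x|]. *)
Lemma Cmod_qpoch_le (x q : C) (n : nat) :
  (Cmod q < 1)%R -> (Cmod (qpoch x q n) <= exp (Cmod x / (1 - Cmod q)))%R.
Proof.
intros Hq. assert (Hq0 := Cmod_ge_0 q). assert (Hx := Cmod_ge_0 x).
apply Rle_trans with (exp (Cmod x * (1 - Cmod q ^ n) / (1 - Cmod q))).
- induction n as [|n IH].
  + simpl. rewrite Cmod_1.
    replace (Cmod x * (1 - 1) / (1 - Cmod q))%R with 0%R by (field; lra).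
    rewrite exp_0. lra.
  + replace (Cmod x * (1 - Cmod q ^ S n) / (1 - Cmod q))%R
      with (Cmod x * (1 - Cmod q ^ n) / (1 - Cmod q) + Cmod q ^ n * Cmod x)%R
      by (simpl; field; lra).
    simpl qpoch. rewrite exp_plus, Cmod_mult.
    apply Rmult_le_compat; auto using Cmod_ge_0.
    apply Rle_trans with (1 := Cmod_1_minus_le _).
    rewrite Cmod_mult, Cmod_pow. apply exp_ineq1_le.
- assert (H : (0 <= Cmod q ^ n)%R) by now apply pow_le.
  apply Rnot_lt_le; intros Hlt. apply exp_lt_inv in Hlt.
  apply Rlt_not_le in Hlt. apply Hlt. unfold Rdiv.
  apply Rmult_le_compat_r; [apply Rlt_le, Rinv_0_lt_compat; lra | nra].
Qed.

Lemma qpoch_tends (x q : C) :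
  (Cmod q < 1)%R -> Ctends (fun n => qpoch x q n) (qpoch_inf x q).
Proof.
intros Hq.
destruct (Ctends_of_geom (fun n => qpoch x q n)
            (exp (Cmod x / (1 - Cmod q)) * Cmod x) (Cmod q)) as [l Hl].
- split; [apply Cmod_ge_0 | exact Hq].
- intros n. simpl.
  replace (qpoch x q n * (1 - q ^ n * x) - qpoch x q n)
    with (- (qpoch x q n * x * q ^ n)) by ring.
  rewrite Cmod_opp, !Cmod_mult, Cmod_pow.
  apply Rmult_le_compat_r; [apply pow_le, Cmod_ge_0 |].
  apply Rmult_le_compat_r; [apply Cmod_ge_0 |].
  now apply Cmod_qpoch_le.
- now apply Ctends_lim with l.
Qed.

Lemma qpoch_inf_S_l (x q : C) :
  (Cmod q < 1)%R -> qpoch_inf x q = (1 - x) * qpoch_inf (q * x) q.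
Proof.
intros Hq. apply Ctends_unique with (fun n => qpoch x q (S n)).
- apply (Ctends_incr_1 (fun n => qpoch x q n)). now apply qpoch_tends.
- assert (H := Ctends_mult _ _ _ _ (Ctends_const (1 - x)) (qpoch_tends (q * x) q Hq)).
  revert H. apply is_lim_seq_ext. intros n. now rewrite qpoch_S_l.
Qed.

(** A vanishing finite factor would annihilate the infinite product, as peeling factors off the left
    shows. So nonvanishing of the infinite products controls the finite denominators built from
    them. *)
Lemma qpoch_neq_0 (x q : C) (n : nat) :
  (Cmod q < 1)%R -> qpoch_inf x q <> 0 -> qpoch x q n <> 0.
Proof.
intros Hq Hx. revert x Hx. induction n as [|n IH]; intros x Hx.
- simpl. apply C1_nz.
- rewrite qpoch_inf_S_l in Hx by exact Hq. rewrite qpoch_S_l.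
  apply Cmult_neq_0.
  + intros E. apply Hx. rewrite E. ring.
  + apply IH. intros E. apply Hx. rewrite E. ring.
Qed.

Lemma qpoch_factor_neq_0 (x q : C) (n : nat) :
  (Cmod q < 1)%R -> qpoch_inf x q <> 0 -> 1 - q ^ n * x <> 0.
Proof.
intros Hq Hx E. apply (qpoch_neq_0 x q (S n) Hq Hx). simpl. rewrite E. ring.
Qed.

Lemma one_minus_pow_S_neq_0 (q : C) (n : nat) : (Cmod q < 1)%R -> 1 - q ^ S n <> 0.
Proof.
intros Hq E. assert (H := Cmod_1_minus_ge (q ^ S n)).
rewrite E, Cmod_0, Cmod_pow in H. simpl in H.
assert (H0 := Cmod_ge_0 q).
assert (H1 : (Cmod q ^ n <= 1)%R) by (apply pow_le_1; lra).
assert (H2 : (0 <= Cmod q ^ n)%R) by now apply pow_le.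
nra.
Qed.

(** * Uniform bounds for powers of q, q-shifted factorials and their inverses *)

Lemma bounded_pow (q : C) (m : nat -> nat -> nat) :
  (Cmod q < 1)%R -> bounded (fun k N => q ^ m k N).
Proof.
intros Hq. exists 1%R. intros k N. rewrite Cmod_pow, <- (pow1 (m k N)).
apply pow_incr. split; [apply Cmod_ge_0 | lra].
Qed.

Lemma bounded_qpoch (q : C) (x : nat -> nat -> C) (m : nat -> nat -> nat) :
  (Cmod q < 1)%R -> bounded x -> bounded (fun k N => qpoch (x k N) q (m k N)).
Proof.
intros Hq [M HM]. exists (exp (M / (1 - Cmod q))). intros k N.
apply Rle_trans with (1 := Cmod_qpoch_le _ q _ Hq).
apply Rnot_lt_le; intros Hlt. apply exp_lt_inv in Hlt.
apply Rlt_not_le in Hlt. apply Hlt. unfold Rdiv.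
apply Rmult_le_compat_r; [apply Rlt_le, Rinv_0_lt_compat; lra | apply HM].
Qed.

(** The inverse equals [(x;q)_j / (x;q)_(j+m)]. The numerators are bounded, and the inverse
    denominators converge because the infinite product is nonzero. *)
Lemma bounded_inv_qpoch (q x : C) (j m : nat -> nat -> nat) :
  (Cmod q < 1)%R -> qpoch_inf x q <> 0 ->
  bounded (fun k N => / qpoch (q ^ j k N * x) q (m k N)).
Proof.
intros Hq Hx.
destruct (Ctends_bounded _ _ (Ctends_inv _ _ Hx (fun n => qpoch_neq_0 x q n Hq Hx)
                                (qpoch_tends x q Hq))) as [M HM].
apply bounded_ext with (fun k N => qpoch x q (j k N) * / qpoch x q (j k N + m k N)).
- intros k N. assert (H1 := qpoch_neq_0 x q (j k N + m k N) Hq Hx). rewrite qpoch_add in H1 |- *.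
  field. split; intros E; apply H1; rewrite E; ring.
- apply bounded_mult.
  + apply (bounded_qpoch q (fun _ _ => x)); [exact Hq | apply bounded_const].
  + exists M. intros k N. apply HM.
Qed.

Lemma bounded_inv_factor (q x : C) (j : nat -> nat -> nat) :
  (Cmod q < 1)%R -> qpoch_inf x q <> 0 -> bounded (fun k N => / (1 - q ^ j k N * x)).
Proof.
intros Hq Hx. apply bounded_ext with (fun k N => / qpoch (q ^ j k N * x) q 1).
- intros k N. simpl. f_equal. ring.
- now apply (bounded_inv_qpoch q x j (fun _ _ => 1%nat)).
Qed.

Lemma bounded_inv_one_minus_pow_S (q : C) (j : nat -> nat -> nat) :
  (Cmod q < 1)%R -> bounded (fun k N => / (1 - q ^ S (j k N))).
Proof.
intros Hq. exists (/ (1 - Cmod q))%R. intros k N.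
rewrite Cmod_inv by now apply one_minus_pow_S_neq_0.
apply Rinv_le_contravar; [lra |].
apply Rle_trans with (2 := Cmod_1_minus_ge _). rewrite Cmod_pow. simpl.
assert (H0 := Cmod_ge_0 q).
assert (H1 : (Cmod q ^ j k N <= 1)%R) by (apply pow_le_1; lra).
nra.
Qed.

Lemma qpoch_q_neq_0 (q : C) (n : nat) : (Cmod q < 1)%R -> qpoch q q n <> 0.
Proof.
intros Hq. induction n as [|n IH]; simpl; [apply C1_nz |].
apply Cmult_neq_0; [exact IH |]. rewrite Cmult_comm. now apply one_minus_pow_S_neq_0.
Qed.

(** Each factor has modulus at least [1 - |q|]. The exponential growth allowed here is later
    absorbed by a power of [q] with quadratic exponent. *)
Lemma Cmod_inv_qpoch_q_le (q : C) (n : nat) :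
  (Cmod q < 1)%R -> (Cmod (/ qpoch q q n) <= (/ (1 - Cmod q)) ^ n)%R.
Proof.
intros Hq.
rewrite Cmod_inv by now apply qpoch_q_neq_0. rewrite pow_inv.
apply Rinv_le_contravar; [apply pow_lt; lra |].
induction n as [|n IH]; simpl.
- rewrite Cmod_1. lra.
- rewrite Cmod_mult, Rmult_comm.
  apply Rmult_le_compat; try lra; [apply pow_le; lra | ].
  apply Rle_trans with (2 := Cmod_1_minus_ge _). rewrite Cmod_mult, Cmod_pow.
  assert (H0 := Cmod_ge_0 q).
  assert (H1 : (Cmod q ^ n <= 1)%R) by (apply pow_le_1; lra).
  nra.
Qed.

(* [L ^ k * r ^ (k * k) = (L * r ^ k) ^ k], and [L * r ^ k <= 1] for large [k]. *)
Lemma pow_mul_pow_sqr_bounded (L r : R) :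
  (0 <= L)%R -> (0 <= r < 1)%R -> exists K, forall k, (L ^ k * r ^ (k * k) <= K)%R.
Proof.
intros HL Hr.
assert (Hm : exists m, (L * r ^ m <= 1)%R).
{ assert (H : is_lim_seq (fun m => (L * r ^ m)%R) (L * 0)%R).
  { apply is_lim_seq_mult'; [apply is_lim_seq_const |].
    apply is_lim_seq_geom. rewrite Rabs_pos_eq; lra. }
  apply is_lim_seq_spec in H. destruct (H (mkposreal 1 Rlt_0_1)) as [m Hm].
  exists m. specialize (Hm m (le_n m)). simpl in Hm.
  apply Rabs_def2 in Hm. lra. }
destruct Hm as [m Hm].
assert (HM : (1 <= Rmax 1 L)%R) by apply Rmax_l.
(* From [k = m] on the value is at most 1; for [k < m] it is at most [Rmax 1 L ^ k]. *)
exists (Rmax 1 L ^ m)%R. intros k.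
rewrite pow_mult, <- Rpow_mult_distr.
assert (Hk : (0 <= r ^ k)%R) by (apply pow_le; lra).
destruct (Nat.le_gt_cases m k) as [Hmk | Hmk].
- apply Rle_trans with 1%R; [| now apply pow_R1_Rle].
  rewrite <- (pow1 k). apply pow_incr. split; [now apply Rmult_le_pos |].
  apply Rle_trans with (2 := Hm). apply Rmult_le_compat_l; [exact HL |].
  replace k with (m + (k - m))%nat by lia. rewrite pow_add.
  assert (0 <= r ^ m)%R by (apply pow_le; lra).
  assert (r ^ (k - m) <= 1)%R by (apply pow_le_1; lra).
  nra.
- apply Rle_trans with (Rmax 1 L ^ k)%R.
  + apply pow_incr. split; [now apply Rmult_le_pos |].
    apply Rle_trans with (L * 1)%R.
    * apply Rmult_le_compat_l; [exact HL |]. now apply pow_le_1.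
    * rewrite Rmult_1_r. apply Rmax_r.
  + apply Rle_pow; [exact HM | lia].
Qed.

(** * The terms of the series and their telescoping relation *)

Lemma qpoch_S (x q : C) (n : nat) : qpoch x q (S n) = qpoch x q n * (1 - q ^ n * x).
Proof. reflexivity. Qed.

Lemma qpoch_inf_pow_neq_0 (x q : C) (N : nat) :
  (Cmod q < 1)%R -> qpoch_inf x q <> 0 -> qpoch_inf (q ^ N * x) q <> 0.
Proof.
intros Hq Hx. induction N as [|N IH].
- simpl. now rewrite Cmult_1_l.
- intros E. apply IH. rewrite qpoch_inf_S_l by exact Hq.
  replace (q * (q ^ N * x)) with (q ^ S N * x) by (simpl; ring). rewrite E. ring.
Qed.

(* Without the denominator [1 - c], so that [c] may be replaced by [q ^ N * c], where
   [1 - q ^ N * c] may vanish when [3] does not divide [N]. *)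
Definition base (q a c e : C) (k : nat) : C :=
  (qpoch a q k * qpoch c q k * qpoch e q k * qpoch (q / e) q k
     * qpoch (a * e / c) q k * qpoch (q * c / (a * e)) q k)
  / (qpoch q q (2 * k) * qpoch (a * e) q (2 * k) * qpoch (q * c / e) q (2 * k))
  * q ^ (3 * k ^ 2 - k) * (a * c) ^ k.

(* The factor [1 - q ^ (3 * k) * c] of the term is absorbed into its braces. *)
Definition bracket (q a c e : C) (k : nat) : C :=
  1 - q ^ (3 * k) * c
  - q ^ (3 * k)
    * (a * (1 - q ^ (3 * k + 1) * a) * (1 - q ^ k * c) * (1 - q ^ k * e)
         * (1 - q ^ k * (q * c / (a * e)))
       / ((1 - q ^ S (2 * k)) * (1 - q ^ (2 * k) * (a * e)) * (1 - q ^ (2 * k) * (q * c / e)))).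

Lemma pow_2k (q : C) (k : nat) : q ^ (2 * k) = q ^ k * q ^ k.
Proof. rewrite <- Cpow_add_r. f_equal. lia. Qed.

Lemma pow_3k (q : C) (k : nat) : q ^ (3 * k) = q ^ k * q ^ k * q ^ k.
Proof. rewrite <- !Cpow_add_r. f_equal. lia. Qed.

Lemma base_S (q a c e : C) (k : nat) :
  (Cmod q < 1)%R -> qpoch_inf (a * e) q <> 0 -> qpoch_inf (q * c / e) q <> 0 ->
  base q a c e (S k)
  = base q a c e k
    * ((1 - q ^ k * a) * (1 - q ^ k * c) * (1 - q ^ k * e) * (1 - q ^ k * (q / e))
         * (1 - q ^ k * (a * e / c)) * (1 - q ^ k * (q * c / (a * e)))
         * (q * q * q ^ (3 * k) * q ^ (3 * k) * (a * c))
       / ((1 - q ^ S (2 * k)) * (1 - q ^ S (S (2 * k)))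
          * ((1 - q ^ (2 * k) * (a * e)) * (1 - q ^ S (2 * k) * (a * e)))
          * ((1 - q ^ (2 * k) * (q * c / e)) * (1 - q ^ S (2 * k) * (q * c / e))))).
Proof.
intros Hq Ha Hc. unfold base.
replace (2 * S k)%nat with (S (S (2 * k))) by lia.
(* The quadratic exponent grows by [6k + 2], split to match [q * q * q^(3k) * q^(3k)] in the
   ratio. *)
replace (3 * S k ^ 2 - S k)%nat with (2 + 3 * k + 3 * k + (3 * k ^ 2 - k))%nat
  by (simpl; nia).
rewrite !qpoch_S, !Cpow_add_r.
replace (q ^ (2 * k) * q) with (q ^ S (2 * k)) by apply Cmult_comm.
replace (q ^ S (2 * k) * q) with (q ^ S (S (2 * k))) by apply Cmult_comm.
assert (H1 := qpoch_q_neq_0 q (2 * k) Hq).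
assert (H2 := qpoch_neq_0 _ _ (2 * k) Hq Ha).
assert (H3 := qpoch_neq_0 _ _ (2 * k) Hq Hc).
assert (H4 := one_minus_pow_S_neq_0 q (2 * k) Hq).
assert (H5 := one_minus_pow_S_neq_0 q (S (2 * k)) Hq).
assert (H6 := qpoch_factor_neq_0 _ _ (2 * k) Hq Ha).
assert (H7 := qpoch_factor_neq_0 _ _ (S (2 * k)) Hq Ha).
assert (H8 := qpoch_factor_neq_0 _ _ (2 * k) Hq Hc).
assert (H9 := qpoch_factor_neq_0 _ _ (S (2 * k)) Hq Hc).
replace (q ^ 2) with (q * q) by (simpl; ring).
replace ((a * c) ^ S k) with (a * c * (a * c) ^ k) by reflexivity.
set (x1 := q * c / e) in *. set (x2 := a * e / c). set (x3 := q * c / (a * e)).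
set (x4 := q / e).
revert H4 H5 H6 H7 H8 H9.
generalize (q ^ S (S (2 * k))) (q ^ S (2 * k)) (q ^ (2 * k)) (q ^ (3 * k)).
intros. field. repeat split; assumption.
Qed.

(** The shift leaves [a e / c] and [q c / (a e)] unchanged, so only the symbols in [a], [c], [a e],
    [q c / e] move, each by a ratio of its end factors; [(a c)^k] contributes [q^(2k)]. *)
Lemma base_shift (q a c e : C) (k : nat) :
  (Cmod q < 1)%R -> q <> 0 -> a <> 0 -> c <> 0 -> e <> 0 ->
  qpoch_inf (a * e) q <> 0 -> qpoch_inf (q * c / e) q <> 0 ->
  (1 - a) * (1 - c) / ((1 - a * e) * (1 - q * c / e)) * base q (q * a) (q * c) e k
  = base q a c e k
    * ((1 - q ^ k * a) * (1 - q ^ k * c) * q ^ (2 * k)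
       / ((1 - q ^ (2 * k) * (a * e)) * (1 - q ^ (2 * k) * (q * c / e)))).
Proof.
intros Hq Hq0 Ha0 Hc0 He0 Ha Hc. unfold base.
replace (q * a * e / (q * c)) with (a * e / c) by (field; auto).
replace (q * (q * c) / (q * a * e)) with (q * c / (a * e)) by (field; auto).
replace (q * a * e) with (q * (a * e)) by ring.
replace (q * (q * c) / e) with (q * (q * c / e)) by (field; auto).
replace ((q * a * (q * c)) ^ k) with (q ^ (2 * k) * (a * c) ^ k)
  by (rewrite pow_2k, <- !Cpow_mult_l; f_equal; ring).
assert (H1 := qpoch_q_neq_0 q (2 * k) Hq).
assert (H2 := qpoch_neq_0 _ _ (2 * k) Hq Ha).
assert (H3 := qpoch_neq_0 _ _ (2 * k) Hq Hc).
assert (H6 := qpoch_factor_neq_0 _ _ (2 * k) Hq Ha).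
assert (H8 := qpoch_factor_neq_0 _ _ (2 * k) Hq Hc).
assert (F1 := qpoch_factor_neq_0 _ _ 0 Hq Ha).
assert (F2 := qpoch_factor_neq_0 _ _ 0 Hq Hc).
simpl in F1, F2. rewrite Cmult_1_l in F1, F2.
assert (Ea := qpoch_shift a q k). assert (Ec := qpoch_shift c q k).
assert (Eae := qpoch_shift (a * e) q (2 * k)).
assert (Ece := qpoch_shift (q * c / e) q (2 * k)).
set (x1 := q * c / e) in *. set (x2 := a * e / c). set (x3 := q * c / (a * e)).
set (x4 := q / e). set (x5 := a * e) in *.
replace (qpoch (q * x5) q (2 * k)) with (qpoch x5 q (2 * k) * (1 - q ^ (2 * k) * x5) / (1 - x5))
  by (rewrite <- Eae; field; auto).
replace (qpoch (q * x1) q (2 * k)) with (qpoch x1 q (2 * k) * (1 - q ^ (2 * k) * x1) / (1 - x1))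
  by (rewrite <- Ece; field; auto).
(* Pairing [1 - a] and [1 - c] with their shifted symbols avoids dividing by them, as they may be
   zero in this lemma. *)
match goal with |- ?L = _ => transitivity
  (((1 - a) * qpoch (q * a) q k) * ((1 - c) * qpoch (q * c) q k)
   * (qpoch e q k * qpoch x4 q k * qpoch x2 q k * qpoch x3 q k
      * q ^ (3 * k ^ 2 - k) * (q ^ (2 * k) * (a * c) ^ k))
   / (qpoch q q (2 * k) * (qpoch x5 q (2 * k) * (1 - q ^ (2 * k) * x5))
      * (qpoch x1 q (2 * k) * (1 - q ^ (2 * k) * x1)))) end.
- field. repeat split; assumption.
- rewrite Ea, Ec. field. repeat split; assumption.
Qed.

(** This is the telescoping relation formally divided by [base q a c e k]: a rational identity in
    [q], [a], [c], [e] and [q^k]. *)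
Lemma bracket_certificate (q a c e : C) (k : nat) :
  (Cmod q < 1)%R -> q <> 0 -> a <> 0 -> c <> 0 -> e <> 0 ->
  qpoch_inf (a * e) q <> 0 -> qpoch_inf (q * c / e) q <> 0 ->
  bracket q a c e k
  - (1 - q ^ k * a) * (1 - q ^ k * c) * q ^ (2 * k)
       / ((1 - q ^ (2 * k) * (a * e)) * (1 - q ^ (2 * k) * (q * c / e)))
    * bracket q (q * a) (q * c) e k
  = (1 - q ^ (2 * k))
    - (1 - q ^ (2 * S k))
      * ((1 - q ^ k * a) * (1 - q ^ k * c) * (1 - q ^ k * e) * (1 - q ^ k * (q / e))
         * (1 - q ^ k * (a * e / c)) * (1 - q ^ k * (q * c / (a * e)))
         * (q * q * q ^ (3 * k) * q ^ (3 * k) * (a * c))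
       / ((1 - q ^ S (2 * k)) * (1 - q ^ S (S (2 * k)))
          * ((1 - q ^ (2 * k) * (a * e)) * (1 - q ^ S (2 * k) * (a * e)))
          * ((1 - q ^ (2 * k) * (q * c / e)) * (1 - q ^ S (2 * k) * (q * c / e))))).
Proof.
intros Hq Hq0 Ha0 Hc0 He0 Ha Hc. unfold bracket.
replace (2 * S k)%nat with (S (S (2 * k))) by lia.
replace (3 * k + 1)%nat with (S (3 * k)) by lia.
assert (H4 := one_minus_pow_S_neq_0 q (2 * k) Hq).
assert (H5 := one_minus_pow_S_neq_0 q (S (2 * k)) Hq).
assert (H6 := qpoch_factor_neq_0 _ _ (2 * k) Hq Ha).
assert (H7 := qpoch_factor_neq_0 _ _ (S (2 * k)) Hq Ha).
assert (H8 := qpoch_factor_neq_0 _ _ (2 * k) Hq Hc).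
assert (H9 := qpoch_factor_neq_0 _ _ (S (2 * k)) Hq Hc).
(* The identity depends on how the powers are related, so all of them are reduced to [q] and
   [Q = q^k]. *)
rewrite !Cpow_S, !pow_2k, ?pow_3k in *.
generalize dependent (q ^ k). intros Q H4 H5 H6 H7 H8 H9.
(* [field] clears the inner division by [e], so it asks for these forms of the denominators. *)
assert (K8 : e - Q * Q * (q * c) <> 0).
{ intros E. apply H8. replace (1 - Q * Q * (q * c / e)) with ((e - Q * Q * (q * c)) / e)
    by (field; assumption). rewrite E. field. assumption. }
assert (K9 : e - q * (Q * Q) * (q * c) <> 0).
{ intros E. apply H9. replace (1 - q * (Q * Q) * (q * c / e)) with ((e - q * (Q * Q) * (q * c)) / e)
    by (field; assumption). rewrite E. field. assumption. }
field. repeat split; assumption.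
Qed.

Lemma base_bracket_telescope (q a c e : C) (k : nat) :
  (Cmod q < 1)%R -> q <> 0 -> a <> 0 -> c <> 0 -> e <> 0 ->
  qpoch_inf (a * e) q <> 0 -> qpoch_inf (q * c / e) q <> 0 ->
  base q a c e k * bracket q a c e k
  - (1 - a) * (1 - c) / ((1 - a * e) * (1 - q * c / e))
    * (base q (q * a) (q * c) e k * bracket q (q * a) (q * c) e k)
  = (1 - q ^ (2 * k)) * base q a c e k - (1 - q ^ (2 * S k)) * base q a c e (S k).
Proof.
intros Hq Hq0 Ha0 Hc0 He0 Ha Hc.
rewrite Cmult_assoc, base_shift, base_S by assumption.
assert (H := bracket_certificate q a c e k Hq Hq0 Ha0 Hc0 He0 Ha Hc).
match type of H with ?L = ?R => transitivity (base q a c e k * L); [ring | rewrite H; ring] end.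
Qed.

(** * Accumulated factors and uniform decay of the terms *)

(** The product of the first [N] factors [rho], divided by [1 - c]: at [N = 0] this restores the
    denominator of the series, and in the limit it turns [(c;q)_oo] into [(qc;q)_oo]. *)
Definition weight (q a c e : C) (N : nat) : C :=
  qpoch a q N * qpoch c q N / (1 - c) / (qpoch (a * e) q N * qpoch (q * c / e) q N).

Lemma weight_S (q a c e : C) (N : nat) :
  (Cmod q < 1)%R -> e <> 0 -> 1 - c <> 0 ->
  qpoch_inf (a * e) q <> 0 -> qpoch_inf (q * c / e) q <> 0 ->
  weight q a c e (S N)
  = weight q a c e N
    * ((1 - q ^ N * a) * (1 - q ^ N * c)
       / ((1 - q ^ N * a * e) * (1 - q * (q ^ N * c) / e))).
Proof.
intros Hq He0 Hc1 Ha Hc. unfold weight. rewrite !qpoch_S.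
assert (H2 := qpoch_neq_0 _ _ N Hq Ha).
assert (H3 := qpoch_neq_0 _ _ N Hq Hc).
assert (H6 := qpoch_factor_neq_0 _ _ N Hq Ha).
assert (H8 := qpoch_factor_neq_0 _ _ N Hq Hc).
replace (q ^ N * a * e) with (q ^ N * (a * e)) by ring.
replace (q * (q ^ N * c) / e) with (q ^ N * (q * c / e)) by (field; auto).
set (x1 := q * c / e) in *.
field. repeat split; assumption.
Qed.

Lemma weight_tends (q a c e : C) :
  (Cmod q < 1)%R -> 1 - c <> 0 ->
  qpoch_inf (a * e) q <> 0 -> qpoch_inf (q * c / e) q <> 0 ->
  Ctends (weight q a c e)
    ((qpoch_inf a q * qpoch_inf (q * c) q)
     / (qpoch_inf (a * e) q * qpoch_inf (q * c / e) q)).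
Proof.
intros Hq Hc1 Ha Hc.
replace (qpoch_inf a q * qpoch_inf (q * c) q) with (qpoch_inf a q * qpoch_inf c q * / (1 - c))
  by (rewrite (qpoch_inf_S_l c) by exact Hq; field; exact Hc1).
apply Ctends_mult.
- apply Ctends_mult; [apply Ctends_mult | apply Ctends_const]; now apply qpoch_tends.
- apply Ctends_inv.
  + now apply Cmult_neq_0.
  + intros n. apply Cmult_neq_0; now apply qpoch_neq_0.
  + apply Ctends_mult; now apply qpoch_tends.
Qed.

Lemma bounded_weight (q a c e : C) :
  (Cmod q < 1)%R -> 1 - c <> 0 ->
  qpoch_inf (a * e) q <> 0 -> qpoch_inf (q * c / e) q <> 0 ->
  bounded (fun _ N => weight q a c e N).
Proof.
intros Hq Hc1 Ha Hc.
destruct (Ctends_bounded _ _ (weight_tends q a c e Hq Hc1 Ha Hc)) as [M HM].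
exists M. intros _ N. apply HM.
Qed.

(** Of the total exponent of [q], the part [(k+1)^2] is kept to beat the exponential growth of
    [(a c)^(k+1) / (q;q)_(2k+2)]; the rest covers [k + N] with a nonnegative surplus. *)
Lemma bounded_base_weight (q a c : C) :
  q <> 0 -> (Cmod q < 1)%R ->
  bounded (fun k N => q ^ (3 * S k ^ 2 - S k) * (q ^ N * a * (q ^ N * c)) ^ S k
                      * / qpoch q q (2 * S k) / q ^ (k + N)).
Proof.
intros Hq0 Hq.
assert (H0 := Cmod_ge_0 q).
(* The square accounts for the two new factors of [(q;q)_(2k)] at each step in [k]. *)
pose (L := (Cmod a * Cmod c * (/ (1 - Cmod q)) ^ 2)%R).
assert (HL : (0 <= L)%R).
{ apply Rmult_le_pos; [apply Rmult_le_pos; apply Cmod_ge_0 |].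
  apply pow_le, Rlt_le, Rinv_0_lt_compat. lra. }
destruct (pow_mul_pow_sqr_bounded L (Cmod q) HL (conj H0 Hq)) as [K HK].
exists K. intros k N.
replace (q ^ (3 * S k ^ 2 - S k) * (q ^ N * a * (q ^ N * c)) ^ S k * / qpoch q q (2 * S k)
         / q ^ (k + N))
  with (q ^ (S k * S k) * (a * c) ^ S k * / qpoch q q (2 * S k)
        * q ^ (2 * k * k + 2 * k + 1 + N + 2 * N * k)).
- rewrite !Cmod_mult, !Cmod_pow, Cmod_mult.
  rewrite <- (Rmult_1_r K). apply Rmult_le_compat.
  + repeat apply Rmult_le_pos; try apply Cmod_ge_0; apply pow_le; try exact H0.
    apply Rmult_le_pos; apply Cmod_ge_0.
  + now apply pow_le.
  + apply Rle_trans with (2 := HK (S k)).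
    replace (L ^ S k)%R with ((Cmod a * Cmod c) ^ S k * (/ (1 - Cmod q)) ^ (2 * S k))%R
      by (unfold L; rewrite (Rpow_mult_distr (Cmod a * Cmod c)), pow_mult; reflexivity).
    replace ((Cmod a * Cmod c) ^ S k * (/ (1 - Cmod q)) ^ (2 * S k) * Cmod q ^ (S k * S k))%R
      with (Cmod q ^ (S k * S k) * (Cmod a * Cmod c) ^ S k * (/ (1 - Cmod q)) ^ (2 * S k))%R
      by ring.
    apply Rmult_le_compat_l; [| now apply Cmod_inv_qpoch_q_le].
    apply Rmult_le_pos; apply pow_le; [exact H0 | apply Rmult_le_pos; apply Cmod_ge_0].
  + now apply pow_le_1.
- replace (q ^ N * a * (q ^ N * c)) with (q ^ (2 * N) * (a * c))
    by (rewrite pow_2k; ring).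
  rewrite (Cpow_mult_l (q ^ (2 * N))), <- Cpow_mult_r.
  assert (E : q ^ (3 * S k ^ 2 - S k) * q ^ (2 * N * S k)
              = q ^ (S k * S k) * q ^ (2 * k * k + 2 * k + 1 + N + 2 * N * k) * q ^ (k + N)).
  { rewrite <- !Cpow_add_r. f_equal. simpl. nia. }
  transitivity (q ^ (3 * S k ^ 2 - S k) * q ^ (2 * N * S k) * (a * c) ^ S k
                * / qpoch q q (2 * S k) / q ^ (k + N)); [rewrite E | ];
  field; split; auto using Cpow_nz; now apply qpoch_q_neq_0.
Qed.

Lemma bounded_base (q a c e : C) :
  q <> 0 -> (Cmod q < 1)%R -> a <> 0 -> c <> 0 -> e <> 0 ->
  qpoch_inf (a * e) q <> 0 -> qpoch_inf (q * c / e) q <> 0 ->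
  bounded (fun k N => base q (q ^ N * a) (q ^ N * c) e (S k) / q ^ (k + N)).
Proof.
intros Hq0 Hq Ha0 Hc0 He0 Ha Hc.
apply bounded_ext with (fun k N =>
  (qpoch (q ^ N * a) q (S k) * qpoch (q ^ N * c) q (S k) * qpoch e q (S k)
     * qpoch (q / e) q (S k) * qpoch (a * e / c) q (S k) * qpoch (q * c / (a * e)) q (S k))
  * (/ qpoch (q ^ N * (a * e)) q (2 * S k) * / qpoch (q ^ N * (q * c / e)) q (2 * S k))
  * (q ^ (3 * S k ^ 2 - S k) * (q ^ N * a * (q ^ N * c)) ^ S k
     * / qpoch q q (2 * S k) / q ^ (k + N))).
- intros k N. unfold base. assert (HN := Cpow_nz q N Hq0).
  replace (q ^ N * a * e / (q ^ N * c)) with (a * e / c) by (field; auto).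
  replace (q * (q ^ N * c) / (q ^ N * a * e)) with (q * c / (a * e)) by (field; auto).
  replace (q ^ N * a * e) with (q ^ N * (a * e)) by ring.
  replace (q * (q ^ N * c) / e) with (q ^ N * (q * c / e)) by (field; auto).
  assert (H1 := qpoch_q_neq_0 q (2 * S k) Hq).
  assert (H2 := qpoch_neq_0 _ _ (2 * S k) Hq (qpoch_inf_pow_neq_0 _ _ N Hq Ha)).
  assert (H3 := qpoch_neq_0 _ _ (2 * S k) Hq (qpoch_inf_pow_neq_0 _ _ N Hq Hc)).
  assert (H4 := Cpow_nz q (k + N) Hq0).
  set (x1 := q ^ N * (q * c / e)) in *. set (x2 := a * e / c). set (x3 := q * c / (a * e)).
  set (x4 := q / e). field. repeat split; assumption.
- apply bounded_mult; [apply bounded_mult |].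
  + do 4 (apply bounded_mult; [| now apply (bounded_qpoch q _ (fun k _ => S k)), bounded_const]).
    apply bounded_mult; apply (bounded_qpoch q _ (fun k _ => S k)); try exact Hq;
      (apply bounded_mult; [now apply (bounded_pow q (fun _ N => N)) | apply bounded_const]).
  + apply bounded_mult; now apply (bounded_inv_qpoch q _ (fun _ N => N) (fun k _ => (2 * S k)%nat)).
  + now apply bounded_base_weight.
Qed.

(** Everything subtracted from 1 in [bracket] carries a factor [a] or [c], hence a factor [q^N]
    after the shift; the explicit family in the proof is what remains once it is cancelled. *)
Lemma bounded_bracket (q a c e : C) :
  q <> 0 -> (Cmod q < 1)%R -> a <> 0 -> e <> 0 ->
  qpoch_inf (a * e) q <> 0 -> qpoch_inf (q * c / e) q <> 0 ->
  bounded (fun k N => (bracket q (q ^ N * a) (q ^ N * c) e k - 1) / q ^ N).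
Proof.
intros Hq0 Hq Ha0 He0 Ha Hc.
apply bounded_ext with (fun k N =>
  - (q ^ (3 * k) * c)
  - q ^ (3 * k)
    * (a * (1 - q ^ (3 * k + 1) * (q ^ N * a)) * (1 - q ^ k * (q ^ N * c)) * (1 - q ^ k * e)
         * (1 - q ^ k * (q * c / (a * e)))
       * (/ (1 - q ^ S (2 * k)) * / (1 - q ^ (2 * k + N) * (a * e))
          * / (1 - q ^ (2 * k + N) * (q * c / e))))).
- intros k N. unfold bracket. assert (HN := Cpow_nz q N Hq0).
  replace (q * (q ^ N * c) / (q ^ N * a * e)) with (q * c / (a * e)) by (field; auto).
  replace (q ^ (2 * k) * (q ^ N * a * e)) with (q ^ (2 * k + N) * (a * e))
    by (rewrite Cpow_add_r; ring).
  replace (q ^ (2 * k) * (q * (q ^ N * c) / e)) with (q ^ (2 * k + N) * (q * c / e))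
    by (rewrite Cpow_add_r; field; auto).
  assert (H4 := one_minus_pow_S_neq_0 q (2 * k) Hq).
  assert (H6 := qpoch_factor_neq_0 _ _ (2 * k + N) Hq Ha).
  assert (H8 := qpoch_factor_neq_0 _ _ (2 * k + N) Hq Hc).
  set (x1 := q * c / e) in *. set (x3 := q * c / (a * e)).
  revert H4 H6 H8 HN.
  generalize (q ^ S (2 * k)) (q ^ (2 * k + N)) (q ^ (3 * k + 1)) (q ^ (3 * k)) (q ^ k) (q ^ N).
  intros. field. repeat split; assumption.
- assert (pw : forall m, bounded (fun k N => q ^ m k N)) by (intros m; now apply bounded_pow).
  apply bounded_minus; [apply bounded_opp, bounded_mult;
    [apply (pw (fun k _ => (3 * k)%nat)) | apply bounded_const] |].
  apply bounded_mult; [apply (pw (fun k _ => (3 * k)%nat)) |].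
  apply bounded_mult.
  + repeat apply bounded_mult; try apply bounded_minus; try apply bounded_const;
    repeat apply bounded_mult; try apply bounded_const.
    * apply (pw (fun k _ => (3 * k + 1)%nat)).
    * apply (pw (fun _ N => N)).
    * apply (pw (fun k _ => k)).
    * apply (pw (fun _ N => N)).
    * apply (pw (fun k _ => k)).
    * apply (pw (fun k _ => k)).
  + repeat apply bounded_mult.
    * now apply (bounded_inv_one_minus_pow_S q (fun k _ => (2 * k)%nat)).
    * now apply (bounded_inv_factor q _ (fun k N => (2 * k + N)%nat)).
    * now apply (bounded_inv_factor q _ (fun k N => (2 * k + N)%nat)).
Qed.

(** * Assembly of the identity *)

Theorem theorem3 (q a c e : C)
  (hq0 : (0 < Cmod q)%R) (hq1 : (Cmod q < 1)%R)
  (ha : a <> 0) (hc : c <> 0) (he : e <> 0)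
  (hck : forall k : nat, 1 - q ^ (3 * k) * c <> 0)
  (hae : qpoch_inf (a * e) q <> 0)
  (hce : qpoch_inf (q * c / e) q <> 0) :
  is_series (K := C_AbsRing) (V := C_NormedModule)
    (fun k : nat =>
       (1 - q ^ (3 * k) * c) / (1 - c)
       * ((qpoch a q k * qpoch c q k * qpoch e q k * qpoch (q / e) q k
             * qpoch (a * e / c) q k * qpoch (q * c / (a * e)) q k)
          / (qpoch q q (2 * k) * qpoch (a * e) q (2 * k)
             * qpoch (q * c / e) q (2 * k)))
       * q ^ (3 * k ^ 2 - k) * (a * c) ^ k
       * (1 - q ^ (3 * k)
              * (a * (1 - q ^ (3 * k + 1) * a) * (1 - q ^ k * c)
                   * (1 - q ^ k * e) * (1 - q ^ (1 + k) * c / (a * e))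
                 / ((1 - q ^ (3 * k) * c) * (1 - q ^ (1 + 2 * k))
                      * (1 - q ^ (2 * k) * a * e)
                      * (1 - q ^ (1 + 2 * k) * c / e)))))
    ((qpoch_inf a q * qpoch_inf (q * c) q)
     / (qpoch_inf (a * e) q * qpoch_inf (q * c / e) q)).
Proof.
assert (Hq0 : q <> 0) by now apply Cmod_gt_0.
assert (Hc1 : 1 - c <> 0).
{ intros E. apply (hck O). simpl. rewrite <- E. ring. }
(* Including the accumulated [weight] turns the relation with factor [rho] into a plain difference
   in [N], and column 0 is the given series. *)
pose (W := fun k N => weight q a c e N
  * (base q (q ^ N * a) (q ^ N * c) e k * bracket q (q ^ N * a) (q ^ N * c) e k)).
pose (G := fun k N => weight q a c e N * (1 - q ^ (2 * k)) * base q (q ^ N * a) (q ^ N * c) e k).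
apply is_series_ext with (fun k => W k O).
{ intros k. unfold W, weight, base, bracket. simpl (qpoch _ _ 0).
  replace (q ^ 0 * a) with a by (simpl; ring). replace (q ^ 0 * c) with c by (simpl; ring).
  replace (1 + 2 * k)%nat with (S (2 * k)) by lia.
  replace (q ^ (1 + k) * c / (a * e)) with (q ^ k * (q * c / (a * e)))
    by (rewrite Cpow_add_r; simpl; field; auto).
  replace (q ^ (2 * k) * a * e) with (q ^ (2 * k) * (a * e)) by ring.
  replace (q ^ S (2 * k) * c / e) with (q ^ (2 * k) * (q * c / e))
    by (rewrite Cpow_S; field; auto).
  assert (H1 := qpoch_q_neq_0 q (2 * k) hq1).
  assert (H2 := qpoch_neq_0 _ _ (2 * k) hq1 hae).
  assert (H3 := qpoch_neq_0 _ _ (2 * k) hq1 hce).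
  assert (H4 := one_minus_pow_S_neq_0 q (2 * k) hq1).
  assert (H6 := qpoch_factor_neq_0 _ _ (2 * k) hq1 hae).
  assert (H8 := qpoch_factor_neq_0 _ _ (2 * k) hq1 hce).
  assert (H9 := hck k).
  set (x1 := q * c / e) in *. set (x2 := a * e / c). set (x3 := q * c / (a * e)).
  set (x4 := q / e).
  revert H4 H6 H8 H9.
  generalize (q ^ S (2 * k)) (q ^ (2 * k)) (q ^ (3 * k + 1)) (q ^ (3 * k)) (q ^ k).
  (* The equality is stated in the carrier of the normed module; [field] has to see it in [C]. *)
  intros. match goal with |- ?L = ?R => change (@eq C L R) end.
  field. repeat split; assumption. }
assert (bw := bounded_weight q a c e hq1 Hc1 hae hce).
assert (bb := bounded_base q a c e Hq0 hq1 ha hc he hae hce).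
assert (bk := bounded_bracket q a c e Hq0 hq1 ha he hae hce).
apply (is_series_double_telescope q W G (weight q a c e)); auto.
- intros k N. unfold W, G.
  rewrite weight_S by assumption.
  assert (HN := Cpow_nz q N Hq0).
  assert (Ha : qpoch_inf (q ^ N * a * e) q <> 0).
  { rewrite <- Cmult_assoc. now apply qpoch_inf_pow_neq_0. }
  assert (Hc : qpoch_inf (q * (q ^ N * c) / e) q <> 0).
  { replace (q * (q ^ N * c) / e) with (q ^ N * (q * c / e)) by (field; auto).
    now apply qpoch_inf_pow_neq_0. }
  assert (H := base_bracket_telescope q (q ^ N * a) (q ^ N * c) e k hq1 Hq0
                 (Cmult_neq_0 _ _ HN ha) (Cmult_neq_0 _ _ HN hc) he Ha Hc).
  rewrite !Cpow_S, <- !(Cmult_assoc q (q ^ N)).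
  match type of H with ?L = ?R =>
    transitivity (weight q a c e N * L); [ring | rewrite H; ring] end.
- intros N. unfold G. simpl. ring.
- apply bounded_ext with (fun k N => weight q a c e N * (1 - q ^ (2 * S k))
    * (base q (q ^ N * a) (q ^ N * c) e (S k) / q ^ (k + N))).
  + intros k N. unfold G, Cdiv. ring.
  + apply bounded_mult; [apply bounded_mult; [exact bw |] | exact bb].
    apply bounded_minus; [apply bounded_const | now apply (bounded_pow q (fun k _ => (2 * S k)%nat))].
- apply bounded_ext with (fun k N => weight q a c e N
    * (base q (q ^ N * a) (q ^ N * c) e (S k) / q ^ (k + N))
    * (1 + q ^ N * ((bracket q (q ^ N * a) (q ^ N * c) e (S k) - 1) / q ^ N))).
  + intros k N. unfold W. field. split; now apply Cpow_nz.
  + apply bounded_mult; [now apply bounded_mult |].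
    apply bounded_plus; [apply bounded_const |].
    apply bounded_mult; [now apply (bounded_pow q (fun _ N => N)) |].
    destruct bk as [M HM]. exists M. intros k N. apply HM.
(* Since [base] is 1 at [k = 0], the gap is [weight] times [bracket - 1]. *)
- apply bounded_ext with (fun _ N => weight q a c e N
    * ((bracket q (q ^ N * a) (q ^ N * c) e 0 - 1) / q ^ N)).
  + intros _ N. unfold W.
    replace (base q (q ^ N * a) (q ^ N * c) e 0) with (RtoC 1).
    * field. now apply Cpow_nz.
    * unfold base. simpl. field.
  + apply bounded_mult; [exact bw |]. destruct bk as [M HM]. exists M. intros _ N. apply HM.
- now apply weight_tends.
Qed.
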